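(* Consider the normal means model $y=\beta+\varepsilon$, $\varepsilon\sim N(0,I_n)$, $\beta\in\mathcal B(n,s_n)$. Then the following non-asymptotic lower bound holds: $$\inf_{\widehat\beta\in\Omega_f}\ \sup_{\beta\in\mathcal B(n,s_n)}E_\beta[\mathrm{FP}(\widehat\beta)]\ \ge\ (n-s_n+1)\,\sup_{c>1}\Phi\Big(\Phi^{-1}(1-1/c)-\{c f(n,s_n)\}^{1/2}\Big).$$ Asymptotically, as $n\to\infty$ with $\limsup_n s_n/n=\zeta\in[0,1)$: (i) if $\limsup_n f(n,s_n)=\kappa<\infty$, then $$\liminf_{n\to\infty}\ \frac1n\ \inf_{\widehat\beta\in\Omega_f}\ \sup_{\beta\in\mathcal B(n,s_n)}E_\beta[\mathrm{FP}(\widehat\beta)]\ \ge\ H(\kappa)(1-\zeta),$$ where $H(\kappa)=\sup_{c>1}\Phi\big(\Phi^{-1}(1-1/c)-\{c\kappa\}^{1/2}\big)\in(0,1)$ is decreasing in $\kappa$; (ii) if $\lim_n f(n,s_n)=\infty$, then there exist an absolute constant $C>0$ and a positive sequence $\epsilon_n\to0$ such that for all sufficiently large $n$ $$\inf_{\widehat\beta\in\Omega_f}\ \sup_{\beta\in\mathcal B(n,s_n)}E_\beta[\mathrm{FP}(\widehat\beta)]\ \ge\ C(1-\zeta)\,n\exp\{-(1+\epsilon_n)f(n,s_n)/2\}.$$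
   Context: $1\le s_n\le n$ are integers. $\mathcal B(n,s_n)=\{\beta\in\mathbb R^n:\|\beta\|_0\le s_n\}$, where $\|\beta\|_0$ is the number of nonzero entries. An estimator is any (measurable) function $\widehat\beta=\widehat\beta(y)\in\mathbb R^n$ of $y$; it is allowed to depend on $s_n$. $E_\beta$ is expectation over $y\sim N(\beta,I_n)$. $\mathrm{FP}(\widehat\beta)=|\{j:\widehat\beta_j\ne0,\ \beta_j=0\}|$ is the number of false positives (false discoveries). For a positive function $f(n,s_n)$, bounded away from $0$, $$\Omega_f=\Big\{\widehat\beta:\ \sup_{\beta\in\mathcal B(n,s_n)}E_\beta\|\beta-\widehat\beta\|^2\le s_nf(n,s_n)\Big\},$$ with $\|\cdot\|$ the Euclidean norm. $\Phi$ is the standard normal distribution function. The infimum over an empty set is $+\infty$. *)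

(* Defs.v *)
From HB Require Import structures.
From mathcomp Require Import all_boot all_order all_algebra.
From mathcomp Require Import all_classical all_reals all_analysis.

Set Implicit Arguments.
Unset Strict Implicit.
Unset Printing Implicit Defensive.
Import Order.TTheory GRing.Theory Num.Theory.
Import numFieldNormedType.Exports.

Local Open Scope classical_set_scope.
Local Open Scope ring_scope.

Section normal_law.
Context {R : realType}.

(* normal_prob is a measure on measurableTypeR R, whose sigma-algebra (but not
   its display) is the one of R. *)
Definition cons_tuple n (p : measurableTypeR R * n.-tuple R) : n.+1.-tuple R :=
  [tuple of (p.1 : R) :: p.2].

Lemma measurable_cons_tuple n :
  measurable_fun [set: measurableTypeR R * n.-tuple R] (@cons_tuple n).
Proof.
exact: (@measurable_cons _ _ _ R (fst : measurableTypeR R * n.-tuple R -> R)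
  _ snd measurable_fst measurable_snd).
Qed.

HB.instance Definition _ n :=
  isMeasurableFun.Build _ _ _ _ (@cons_tuple n) (@measurable_cons_tuple n).

(* N(b, I_n) on R^n: the product of the N(b_j, 1), obtained by transporting
   iterated binary product measures from R * n.-tuple R to n.+1.-tuple R;
   normal_law_box below pins it down on boxes. *)
Fixpoint normal_law n : n.-tuple R -> probability (n.-tuple R) R :=
  match n with
  | 0 => fun _ => \d_[tuple]
  | m.+1 => fun b => distribution
      (normal_prob (thead b) 1 \x (normal_law (behead_tuple b : m.-tuple R)))%E
      (@cons_tuple m)
  end.

Lemma normal_law_box n (b : n.-tuple R) (A : 'I_n -> set R) :
  (forall j, measurable (A j)) ->
  (normal_law b [set y | forall j, A j (tnth y j)] =
   \prod_(j < n) normal_prob (tnth b j) 1 (A j))%E.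
Proof.
elim: n b A => [|n IHn] b A mA.
  by rewrite big_ord0 /= diracE mem_set// => -[].
rewrite big_ord_recl -[RHS]/(_ * _)%E.
set B := [set y : n.-tuple R | forall j, A (lift ord0 j) (tnth y j)].
have mB : measurable B.
  rewrite (_ : B = \bigcap_(j in [set: 'I_n])
      ((@tnth n R)^~ j @^-1` A (lift ord0 j))).
    apply: fin_bigcap_measurable => // j _.
    by rewrite -[X in measurable X]setTI; exact: measurable_tnth.
  by apply/seteqP; split => y /= yB j; [move=> _|]; exact: yB.
rewrite /= /distribution /pushforward /=.
rewrite (_ : _ @^-1` _ = A ord0 `*` B).
  rewrite product_measure1E//; last exact: mA.
  congr (_ * _)%E.
  apply: (etrans (IHn (behead_tuple b) (fun j => A (lift ord0 j)) _)) => //.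
  apply: eq_bigr => j _; congr (normal_prob _ _ _).
  by rewrite tnth_behead; congr tnth; apply/val_inj; rewrite /= inordK// ltnS.
apply/seteqP; split => -[x y] /=.
  move=> h; split => [|j]; first exact: (h ord0).
  by have := h (lift ord0 j); rewrite /cons_tuple tnthS.
move=> [Ax By] j; case: (unliftP ord0 j) => [k ->|->]; last exact: Ax.
by rewrite /cons_tuple tnthS; exact: By.
Qed.

End normal_law.

Section normal_means.
Context {R : realType}.

Definition Phi (x : R) : R := fine (normal_prob 0 1 `]-oo, x]).

(* Inverse of Phi on its range ]0, 1[, and 0 outside of it. *)
Definition PhiV : R -> R := 'pinv_(fun=> 0) [set: R] Phi.

Definition Hfun (k : R) : R :=
  sup [set Phi (PhiV (1 - 1 / c) - Num.sqrt (c * k)) | c in [set c : R | 1 < c]].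

Definition sparse n (s : nat) : set (n.-tuple R) :=
  [set b | (#|[set j | tnth b j != 0%R]%SET| <= s)%N].
Arguments sparse : clear implicits.

(* Squared Euclidean norm of b - c. *)
Definition sqdist n (b c : n.-tuple R) : R :=
  \sum_(j < n) (tnth b j - tnth c j) ^+ 2.

Definition FP n (b bhat : n.-tuple R) : nat :=
  #|[set j | (tnth bhat j != 0%R) && (tnth b j == 0%R)]%SET|.

Definition Omega (f : nat -> nat -> R) n (s : nat) :
    set (n.-tuple R -> n.-tuple R) :=
  [set bhat | measurable_fun [set: n.-tuple R] bhat /\
    (ereal_sup [set 'E_(normal_law b)[fun y => sqdist b (bhat y)]
               | b in sparse n s] <= (s%:R * f n s)%:E)%E].
Arguments Omega : clear implicits.

(* +oo when Omega f n s is empty. *)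
Definition minimaxFP (f : nat -> nat -> R) n (s : nat) : \bar R :=
  ereal_inf [set ereal_sup [set 'E_(normal_law b)[fun y => (FP b (bhat y))%:R]
                           | b in sparse n s]%E
            | bhat in Omega f n s].

End normal_means.

(* Main.v *)
Require Import Defs.
From HB Require Import structures.
From mathcomp Require Import all_boot all_order all_algebra.
From mathcomp Require Import all_classical all_reals all_analysis.
From mathcomp Require Import measurable_realfun ring lra.

Set Implicit Arguments.
Unset Strict Implicit.
Unset Printing Implicit Defensive.
Import Order.TTheory GRing.Theory Num.Theory.
Import numFieldNormedType.Exports.

Local Open Scope classical_set_scope.
Local Open Scope ring_scope.

(** Fix [c > 1], put [t = sqrt (c f)] and consider the means [t 1_S] for all
    supports [S].  If [#|S| = s], each coordinate of [S] set to zero by the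
    estimator costs [t^2] in squared error, so the risk constraint says that on
    average over the pairs [(S, j)], [j \in S], the coordinate [j] is missed with
    probability at most [f / t^2 = 1 / c].  Removing [j] from [S] changes the law
    of [y] by a likelihood ratio which depends on [y_j] only and in the same way
    for all pairs; hence the Neyman-Pearson inequality against the test
    [tau <= y_j] can be averaged over all pairs, and bounds from below the average
    over the supports of size [s - 1] of the expected number of false positives.

    Both asymptotic claims follow from this bound: (i) by continuity in [k] of the
    terms of the supremum [Hfun k], (ii) by taking [c] close to [1] and using
    [Phi (- x) >= const * exp (- (x + 1)^2 / 2)]. *)

(** * Density and distribution function of the normal law on the line *)

Section standard_normal.
Context {R : realType}.
Implicit Types (x y z m t a b k : R) (D : set R).
Local Notation mu := lebesgue_measure.

Lemma normal_pdf1E m x :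
  normal_pdf m 1 x = normal_peak 1 * expR (- (x - m) ^+ 2 / 2).
Proof. by rewrite normal_pdfE ?oner_neq0// /normal_fun expr1n. Qed.

Lemma normal_prob_scale_le m1 m2 a b D : measurable D -> 0 <= a ->
  (forall x, D x -> a * normal_pdf m1 1 x <= b * normal_pdf m2 1 x) ->
  0 <= b ->
  (a%:E * normal_prob m1 1 D <= b%:E * normal_prob m2 1 D)%E.
Proof.
move=> mD a0 h b0.
have mpdf m : measurable_fun (D : set (measurableTypeR R))
    (fun x => (normal_pdf m 1 x)%:E).
  by apply/measurable_EFinP/measurable_funTS; exact: measurable_normal_pdf.
have pdf0 m x : D x -> (0 <= (normal_pdf m 1 x)%:E)%E.
  by move=> _; rewrite lee_fin normal_pdf_ge0.
rewrite /normal_prob -!ge0_integralZl//; try exact: pdf0; try exact: mpdf.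
apply: ge0_le_integral => //.
- by move=> x Dx; rewrite -EFinM lee_fin mulr_ge0// normal_pdf_ge0.
- exact: measurable_funeM.
- exact: measurable_funeM.
Qed.

(** The substitution [x |-> m - x] carries the density of [N(m, 1)] to the standard one, which is
    even, and turns the right tail into a left tail. *)
Lemma normal_prob_tailE m t : normal_prob m 1 `[t, +oo[ = (Phi (m - t))%:E.
Proof.
rewrite /Phi fineK; last exact: fin_num_measure.
rewrite /normal_prob.
have DF : ((fun x : R => m - x)^`())%classic = cst (-1).
  apply/funext => x; rewrite derive1E deriveB// derive_cst derive_id.
  by rewrite sub0r.
rewrite (@decreasing_ge0_integration_by_substitutiony R (fun x => m - x)).
- apply: eq_integral => x _; rewrite DF !fctE opprK mulr1; congr EFin.
  rewrite /= [LHS]normal_pdf1E [RHS]normal_pdf1E subr0.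
  by rewrite -(sqrrN (m - x)) opprB.
- by move=> x y _ _ xy; rewrite ltrD2l ltrN2.
- by rewrite DF => x _; exact: cvg_cst.
- by rewrite DF; exact: is_cvg_cst.
- by rewrite DF; exact: is_cvg_cst.
- split.
    by move=> x _; exact: derivableB.
  by apply: cvgB; [exact: cvg_cst|exact: cvg_at_right_filter].
- apply/cvgrNyPle => A; near=> x.
  rewrite lerBlDr -lerBlDl.
  near: x; apply: nbhs_pinfty_ge; exact: num_real.
- by apply: continuous_subspaceT; apply: continuous_normal_pdf; rewrite oner_neq0.
- by move=> x _; exact: normal_pdf_ge0.
Unshelve. all: by end_near. Qed.

Lemma Phi_ge0 x : 0 <= Phi x.
Proof. exact: fine_ge0. Qed.

Lemma Phi_le1 x : Phi x <= 1.
Proof.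
rewrite -lee_fin fineK; last exact: fin_num_measure.
exact: probability_le1.
Qed.

Lemma PhiB x y : x <= y -> Phi y - Phi x = fine (normal_prob 0 1 `]x, y]).
Proof.
move=> xy; apply/eqP; rewrite subr_eq addrC -eqe EFinD !fineK; try exact: fin_num_measure.
rewrite -measureU//; last first.
  by apply/seteqP; split => z//=; rewrite !in_itv/= => -[zx /andP[]]; rewrite ltNge zx.
apply/eqP; congr (normal_prob _ _ _).
by rewrite -itv_bndbnd_setU.
Qed.

(** The density never exceeds its peak. This makes [Phi] Lipschitz, hence continuous. *)
Lemma PhiB_le x y : x <= y -> Phi y - Phi x <= normal_peak 1 * (y - x).
Proof.
move=> xy; rewrite PhiB// -lee_fin fineK; last exact: fin_num_measure.
rewrite /normal_prob.
apply: (@le_trans _ _ (\int[mu]_(z in `]x, y]) (normal_peak 1)%:E)%E).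
  apply: ge0_le_integral => //.
  - by move=> z _; rewrite lee_fin normal_pdf_ge0.
  - by apply/measurable_EFinP/measurable_funTS; exact: measurable_normal_pdf.
  - by move=> z _; rewrite lee_fin normal_pdf_ub// oner_neq0.
rewrite integral_cst//= lebesgue_measure_itv/= lte_fin.
case: ifPn => //=.
by rewrite mule0 lee_fin mulr_ge0 ?normal_peak_ge0 ?subr_ge0.
Qed.

Lemma PhiB_ge x y k : x <= y -> 0 <= k ->
  (forall z, x <= z <= y -> k <= normal_pdf 0 1 z) ->
  k * (y - x) <= Phi y - Phi x.
Proof.
move=> xy k0 h; rewrite PhiB// -lee_fin fineK; last exact: fin_num_measure.
rewrite /normal_prob.
apply: (@le_trans _ _ (\int[mu]_(z in `]x, y]) k%:E)%E); last first.
  apply: ge0_le_integral => //.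
  - by apply/measurable_EFinP/measurable_funTS; exact: measurable_normal_pdf.
  - move=> z /=; rewrite in_itv/= => /andP[xz zy].
    by rewrite lee_fin h// zy ltW.
rewrite integral_cst//= lebesgue_measure_itv/= lte_fin.
case: ifPn => //=.
by rewrite -leNgt => yx; rewrite mule0 lee_fin mulr_ge0_le0// subr_le0.
Qed.

Lemma Phi_lt : {homo @Phi R : x y / x < y}.
Proof.
move=> x y xy; rewrite -subr_gt0.
(* Every point of [[x, y]] has modulus at most [|x| + |y|], so the density there is at least its
   value at [|x| + |y|]. *)
apply: (@lt_le_trans _ _ (normal_peak 1 * expR (- (`|x| + `|y|) ^+ 2 / 2) * (y - x))).
  by rewrite !mulr_gt0 ?expR_gt0 ?normal_peak_gt0 ?subr_gt0 ?oner_neq0.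
apply: PhiB_ge; [exact: ltW| |].
  by rewrite mulr_ge0 ?expR_ge0 ?normal_peak_ge0.
move=> z /andP[xz zy]; rewrite normal_pdf1E subr0.
rewrite ler_wpM2l ?normal_peak_ge0// ler_expR ler_pM2r ?invr_gt0//.
rewrite lerN2 -real_normK ?num_real// ler_sqr ?nnegrE ?addr_ge0//.
rewrite ler_norml; apply/andP; split.
  by rewrite lerNl; have := ler_norm (- x); rewrite normrN; have := normr_ge0 y; lra.
by have := ler_norm y; have := normr_ge0 x; lra.
Qed.

Lemma Phi_mono : {mono @Phi R : x y / x <= y}.
Proof. exact/le_mono/Phi_lt. Qed.

Lemma Phi_mono_lt : {mono @Phi R : x y / x < y}.
Proof. exact/leW_mono/Phi_mono. Qed.

Lemma Phi_gt0 x : 0 < Phi x.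
Proof. by rewrite (le_lt_trans (Phi_ge0 (x - 1)))// Phi_mono_lt; lra. Qed.

Lemma Phi_lt1 x : Phi x < 1.
Proof. by rewrite (lt_le_trans _ (Phi_le1 (x + 1)))// Phi_mono_lt; lra. Qed.

Lemma continuous_Phi : continuous (@Phi R).
Proof.
move=> x; apply/cvgrPdist_le => e e0.
have p0 : 0 < @normal_peak R 1 by rewrite normal_peak_gt0// oner_neq0.
have d0 : 0 < e / normal_peak 1 by rewrite divr_gt0.
near=> y.
apply: (@le_trans _ _ (normal_peak 1 * `|x - y|)).
  have [xy|yx] := leP x y.
    rewrite !ler0_norm ?subr_le0 ?Phi_mono// !opprB.
    exact: PhiB_le.
  rewrite !ger0_norm ?subr_ge0 ?Phi_mono ?(ltW yx)//.
  exact/PhiB_le/ltW.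
rewrite mulrC -ler_pdivlMr// ltW//.
Unshelve. all: by end_near. Qed.

(** For [y >= 0], [(y + x)^2 >= x^2 + y^2]: on the nonnegative half-line the density of [N(- x, 1)]
    is at most [expR (- x ^+ 2 / 2)] times the standard one. *)
Lemma PhiN_le x : 0 <= x -> Phi (- x) <= expR (- x ^+ 2 / 2).
Proof.
move=> x0; have := normal_prob_tailE (- x) 0; rewrite subr0 => tE.
rewrite -lee_fin -tE -[leLHS]mul1e.
apply: (@le_trans _ _ ((expR (- x ^+ 2 / 2))%:E * normal_prob 0 1 `[0%R, +oo[)%E).
  apply: normal_prob_scale_le; rewrite ?expR_ge0// => y /=.
  rewrite in_itv/= andbT => y0; rewrite !normal_pdf1E mul1r mulrCA.
  rewrite ler_wpM2l ?normal_peak_ge0// -expRD ler_expR.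
  have := mulr_ge0 x0 y0; nra.
rewrite -[leRHS]mule1 lee_wpmul2l ?lee_fin ?expR_ge0//.
exact: probability_le1.
Qed.

Lemma Phi_ge_onem x : 1 - Phi (- x) <= Phi x.
Proof.
rewrite lerBlDr -lee_fin EFinD.
have := normal_prob_tailE 0 x; rewrite sub0r => <-.
rewrite fineK; last exact: fin_num_measure.
rewrite -(@probability_setT _ _ _ (normal_prob 0 1 : probability _ R)).
rewrite (_ : setT = `]-oo, x] `|` `[x, +oo[).
  by apply: (@measureU2 _ _ _ (normal_prob 0 1 : probability _ R)).
apply/seteqP; split => // y _ /=; rewrite !in_itv/= andbT.
by case: (leP y x) => [|/ltW]; [left|right].
Qed.

(** Only the mass of the unit interval ending at [- x] is kept; the density there is at least its
    value at [x + 1]. *)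
Lemma PhiN_ge x : 0 <= x ->
  normal_peak 1 * expR (- (x + 1) ^+ 2 / 2) <= Phi (- x).
Proof.
move=> x0; set k := normal_peak 1 * _.
suff : k * (- x - (- x - 1)) <= Phi (- x) - Phi (- x - 1).
  by have := Phi_ge0 (- x - 1); nra.
apply: PhiB_ge; first lra.
  by rewrite mulr_ge0 ?expR_ge0 ?normal_peak_ge0.
move=> z /andP[h1 h2]; rewrite normal_pdf1E subr0.
rewrite ler_wpM2l ?normal_peak_ge0// ler_expR; nra.
Qed.

End standard_normal.

(** * The quantile function [PhiV] and the supremum [Hfun] *)

Section PhiV_Hfun.
Context {R : realType}.
Implicit Types (x y k c : R).

Lemma Phi_surj (p : R) : 0 < p < 1 -> exists x, Phi x = p.
Proof.
move=> /andP[p0 p1].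
pose e := Num.min p (1 - p).
have e0 : 0 < e by rewrite lt_min p0 subr_gt0.
have e1 : e <= 1 by rewrite ge_min (ltW p1).
(* This [x] solves [expR (- x ^+ 2 / 2) = e], so that [Phi (- x) <= e <= p] and
   [p <= 1 - e <= Phi x] bracket [p] for the intermediate value theorem. *)
pose x := Num.sqrt (- ln e * 2).
have PN : Phi (- x) <= e.
  apply: (le_trans (PhiN_le (sqrtr_ge0 _))).
  rewrite sqr_sqrtr; last by rewrite mulr_ge0// oppr_ge0 ln_le0.
  by rewrite -mulNr opprK mulfK ?pnatr_eq0// lnK.
have x0 : 0 <= x := sqrtr_ge0 _.
have xx : - x <= x by lra.
have := @IVT R Phi (- x) x p xx (continuous_subspaceT (@continuous_Phi R)).
have [ep ep1] : e <= p /\ e <= 1 - p.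
  by split; rewrite ge_min lexx ?orbT.
have mp : Phi (- x) <= p := le_trans PN ep.
have pM : p <= Phi x by have := Phi_ge_onem x; lra.
rewrite min_l ?Phi_mono// max_r ?Phi_mono// mp pM => /(_ isT)[y _ <-].
by exists y.
Qed.

Lemma PhiVK (p : R) : 0 < p < 1 -> Phi (PhiV p) = p.
Proof.
move=> /Phi_surj[x <-]; apply: pinvK.
by rewrite inE/=; exists x.
Qed.

Lemma PhiVK_inv c : 1 < c -> Phi (PhiV (1 - 1 / c)) = 1 - 1 / c.
Proof.
move=> c1; apply: PhiVK.
have c0 : 0 < c by rewrite (lt_trans _ c1).
rewrite div1r; apply/andP; split; first by rewrite subr_gt0 invf_lt1.
by rewrite ltrBlDr ltrDl invr_gt0.
Qed.

Lemma Hfun_ge k c : 1 < c -> Phi (PhiV (1 - 1 / c) - Num.sqrt (c * k)) <= Hfun k.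
Proof.
move=> c1; apply: sup_ubound; last by exists c.
by exists 1 => _ [d _ <-]; exact: Phi_le1.
Qed.

Lemma Hfun_le k b :
  (forall c, 1 < c -> Phi (PhiV (1 - 1 / c) - Num.sqrt (c * k)) <= b) ->
  Hfun k <= b.
Proof.
move=> h; apply: ge_sup; last by move=> _ [c c1 <-]; exact: h.
by exists (Phi (PhiV (1 - 1 / 2) - Num.sqrt (2 * k))); exists 2 => //=; lra.
Qed.

(** With [u] the quantile, the tail bound gives [expR (u ^+ 2 / 2) <= c]. This is weakened through
    [expR x >= x] to the scale [sqrt c], on which [u] can be compared with [sqrt (c * k)]. *)
Lemma PhiV_inv_le c : 1 < c -> 0 <= PhiV (1 - 1 / c) ->
  PhiV (1 - 1 / c) ^+ 2 <= 4 * Num.sqrt c.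
Proof.
move=> c1; set u := PhiV _ => u0.
have c0 : 0 < c by rewrite (lt_trans _ c1).
have h : 1 / c <= expR (- u ^+ 2 / 2).
  apply: le_trans (PhiN_le u0); have := Phi_ge_onem u.
  by rewrite PhiVK_inv//; lra.
have {}h : expR (u ^+ 2 / 2) <= c.
  move: h; rewrite mulNr expRN div1r lef_pV2 ?posrE ?expR_gt0//.
have hs : (u ^+ 2 / 4) ^+ 2 <= c.
  apply: le_trans h.
  rewrite (_ : u ^+ 2 / 2 = u ^+ 2 / 4 + u ^+ 2 / 4); last by field.
  have q0 : 0 <= u ^+ 2 / 4 by rewrite divr_ge0// sqr_ge0.
  rewrite expRD -expr2 ler_sqr ?nnegrE ?expR_ge0//.
  by apply: le_trans (expR_ge1Dx _); rewrite lerDr.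
have q0 : 0 <= u ^+ 2 / 4 by rewrite divr_ge0// sqr_ge0.
have := ler_wsqrtr hs; rewrite sqrtr_sqr ger0_norm// ler_pdivrMr// mulrC; exact.
Qed.

(** The bound does not depend on [c], which keeps [Hfun k] away from 1. For a quantile [u >= 0] and
    [a = sqrt k], the difference is at most [u - a * u^2 / 4], and completing the square bounds this
    by [1 / a]. *)
Lemma PhiV_inv_sub_sqrt_le k c : 0 < k -> 1 < c ->
  PhiV (1 - 1 / c) - Num.sqrt (c * k) <= (Num.sqrt k)^-1.
Proof.
move=> k0 c1; set u := PhiV _.
have a0 : 0 < Num.sqrt k by rewrite sqrtr_gt0.
have c0 : 0 <= c by rewrite ltW// (lt_trans _ c1).
have [u0|/ltW u0] := leP 0 u; last first.
  by rewrite lerBlDr (le_trans u0)// addr_ge0// ?invr_ge0 sqrtr_ge0.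
have := PhiV_inv_le c1 u0; rewrite -/u => hu.
rewrite sqrtrM//; set a := Num.sqrt k in a0 *; set s := Num.sqrt c in hu *.
rewrite -(ler_pM2r a0) mulVf ?gt_eqF//.
have := sqr_ge0 (a * u / 2 - 1).
have : a ^+ 2 * u ^+ 2 <= a ^+ 2 * (4 * s) by rewrite ler_wpM2l ?sqr_ge0.
nra.
Qed.

Lemma Hfun_gt0 k : 0 < Hfun k.
Proof.
by apply: lt_le_trans (Phi_gt0 _) (@Hfun_ge k 2 _); rewrite ltr1n.
Qed.

Lemma Hfun_bounds k : 0 < k -> 0 < Hfun k < 1.
Proof.
move=> k0; rewrite Hfun_gt0/=.
apply: le_lt_trans (Phi_lt1 (Num.sqrt k)^-1).
by apply: Hfun_le => c c1; rewrite Phi_mono PhiV_inv_sub_sqrt_le.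
Qed.

(** Strictness has to survive the supremum: since [c > 1], passing from [k] to [k'] lowers the
    argument of [Phi] by at least [d = sqrt k' - sqrt k], uniformly in [c]. If
    [Hfun k <= Hfun k' = Phi w], then every term at [k'] is at most [Phi (w - d)], which is
    absurd. *)
Lemma Hfun_decreasing k k' : 0 < k -> k < k' -> Hfun k' < Hfun k.
Proof.
move=> k0 kk'; have k'0 : 0 < k' := lt_trans k0 kk'.
have [w wE] := Phi_surj (Hfun_bounds k'0).
pose d := Num.sqrt k' - Num.sqrt k.
have d0 : 0 < d by rewrite subr_gt0 ltr_sqrt.
rewrite ltNge; apply/negP => Hle.
suff : Hfun k' <= Phi (w - d) by rewrite -wE Phi_mono lerDl oppr_ge0 leNgt d0.
apply: Hfun_le => c c1; rewrite Phi_mono.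
have := le_trans (Hfun_ge k c1) Hle; rewrite -wE Phi_mono.
have c0 : 0 <= c by rewrite ltW// (lt_trans _ c1).
have s1 : 1 <= Num.sqrt c by rewrite -sqrtr1 ler_wsqrtr// ltW.
by rewrite !sqrtrM//; move: d0 s1; rewrite /d; clear; nra.
Qed.

(** The single term [c = 1 + eta / 2] suffices: its leading exponent is [c * k / 2], and the
    remaining [eta * k / 4] absorbs the lower-order terms. *)
Lemma Hfun_ge_expR (eta : R) : 0 < eta ->
  exists K, forall k, K <= k -> 0 < k -> expR (- ((1 + eta) * k / 2)) <= Hfun k.
Proof.
move=> eta0; pose c := 1 + eta / 2; pose q := PhiV (1 - 1 / c).
pose A := `|q| + 1; pose L := - ln (@normal_peak R 1); pose b := eta / (2 * c).
have c1 : 1 < c by rewrite ltrDl divr_gt0.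
have c0 : 0 < c by rewrite (lt_trans _ c1).
have b0 : 0 < b by rewrite divr_gt0// mulr_gt0.
have p0 : 0 < @normal_peak R 1 by rewrite normal_peak_gt0// oner_neq0.
(* Here [b * w ^+ 2 = eta / 2 * k] is the available slack. Half of it pays for the cross term
   [2 * A * w], up to a constant; [K] is such that the other half exceeds all the constants. *)
exists (2 / b * (2 * A ^+ 2 / b + A ^+ 2 + 2 * `|L|)) => k Kk k0.
apply: le_trans (Hfun_ge _ c1); rewrite -/q.
set w := Num.sqrt (c * k).
have w0 : 0 <= w by rewrite sqrtr_ge0.
have w2 : w ^+ 2 = c * k by rewrite sqr_sqrtr// mulr_ge0// ltW.
apply: (@le_trans _ _ (Phi (- (`|q| + w)))); last first.
  by rewrite Phi_mono opprD lerD2r lerNl; have := ler_norm (- q); rewrite normrN.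
apply: le_trans (PhiN_ge _); last by rewrite addr_ge0.
rewrite -[normal_peak 1]lnK ?posrE// -expRD ler_expR -[ln _]opprK -/L.
rewrite (_ : `|q| + w + 1 = w + A); last by rewrite /A; ring.
have LL : L <= `|L| := ler_norm L.
have bw : b * w ^+ 2 = eta / 2 * k by rewrite w2 /b; field; rewrite gt_eqF.
have wk : k <= w ^+ 2 by rewrite w2; nra.
have Kb : 2 * A ^+ 2 / b + A ^+ 2 + 2 * `|L| <= b / 2 * w ^+ 2.
  have : b / 2 * (2 / b * (2 * A ^+ 2 / b + A ^+ 2 + 2 * `|L|)) <= b / 2 * w ^+ 2.
    by apply: ler_wpM2l (le_trans Kk wk); rewrite divr_ge0// ltW.
  by rewrite mulrA (_ : b / 2 * (2 / b) = 1) ?mul1r//; field; rewrite gt_eqF.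
(* AM-GM: [2 A w <= b w^2 / 2 + 2 A^2 / b] *)
have amgm : 2 * A * w <= b / 2 * w ^+ 2 + 2 * A ^+ 2 / b.
  rewrite -subr_ge0 (_ : _ - _ = b / 2 * (w - 2 * A / b) ^+ 2).
    by rewrite mulr_ge0 ?sqr_ge0// divr_ge0// ltW.
  by field; rewrite gt_eqF.
have ck : w ^+ 2 = k + eta / 2 * k by rewrite w2 /c; ring.
rewrite sqrrD; lra.
Qed.

End PhiV_Hfun.

(** * Comparison of product measures, and of normal laws differing in one mean *)

Section normal_law_shift.
Context {R : realType}.
Local Open Scope ereal_scope.

Lemma product_measure1_le d1 d2 (T1 : measurableType d1) (T2 : measurableType d2)
    (P : {measure set T1 -> \bar R}) (Q1 Q2 : {sigma_finite_measure set T2 -> \bar R})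
    (a1 a2 : R) (E : set (T1 * T2)) : measurable E ->
  (0 <= a1)%R -> (0 <= a2)%R ->
  (forall x, a1%:E * Q1 (xsection E x) <= a2%:E * Q2 (xsection E x)) ->
  a1%:E * (P \x Q1) E <= a2%:E * (P \x Q2) E.
Proof.
move=> mE a10 a20 h; rewrite /product_measure1.
have m1 := measurable_fun_xsection Q1 mE.
have m2 := measurable_fun_xsection Q2 mE.
rewrite -ge0_integralZl//=.
rewrite -[leRHS]ge0_integralZl//=.
apply: ge0_le_integral => //=.
- by move=> x _; rewrite mule_ge0.
- exact: measurable_funeM.
- exact: measurable_funeM.
Qed.

Lemma product_measure2_le d1 d2 (T1 : measurableType d1) (T2 : measurableType d2)
    (P1 P2 : {sigma_finite_measure set T1 -> \bar R})
    (Q : {sigma_finite_measure set T2 -> \bar R})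
    (a1 a2 : R) (E : set (T1 * T2)) : measurable E ->
  (0 <= a1)%R -> (0 <= a2)%R ->
  (forall y, a1%:E * P1 (ysection E y) <= a2%:E * P2 (ysection E y)) ->
  a1%:E * (P1 \x Q) E <= a2%:E * (P2 \x Q) E.
Proof.
move=> mE a10 a20 h.
(* Uniqueness of the product measure allows integrating in the other order, so that the differing
   factors are applied to the sections. *)
rewrite (product_measure_unique (product_measure2E P1 Q))//.
rewrite (product_measure_unique (product_measure2E P2 Q))//.
rewrite /= /product_measure2.
have m1 := measurable_fun_ysection P1 mE.
have m2 := measurable_fun_ysection P2 mE.
rewrite -ge0_integralZl//=.
rewrite -[leRHS]ge0_integralZl//=.
apply: ge0_le_integral => //=.
- by move=> x _; rewrite mule_ge0.
- exact: measurable_funeM.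
- exact: measurable_funeM.
Qed.

(** The other coordinates have the same law, so comparing the densities of [y_j] is enough. By
    induction on [n]: [j] is either the first factor of the product or lies in the second. *)
Lemma normal_law_scale_le n (j : 'I_n) (b1 b2 : n.-tuple R) (a1 a2 : R)
    (D : set (n.-tuple R)) :
  (forall i, i != j -> tnth b1 i = tnth b2 i) ->
  measurable D -> (0 <= a1)%R -> (0 <= a2)%R ->
  (forall y, D y -> (a1 * normal_pdf (tnth b1 j) 1 (tnth y j) <=
                     a2 * normal_pdf (tnth b2 j) 1 (tnth y j))%R) ->
  a1%:E * normal_law b1 D <= a2%:E * normal_law b2 D.
Proof.
elim: n j b1 b2 D => [[]//|n IHn] j b1 b2 D b12 mD a10 a20 h.
have tnth_behead' (b : n.+1.-tuple R) (i : 'I_n) :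
    tnth (behead_tuple b) i = tnth b (lift ord0 i).
  by rewrite tnth_behead; congr tnth; apply/val_inj; rewrite /= inordK// ltnS.
have mE : measurable (@Defs.cons_tuple R n @^-1` D).
  by rewrite -[X in measurable X]setTI; exact: measurable_cons_tuple.
rewrite /= /distribution /pushforward /=.
case: (unliftP ord0 j) => [k jk|j0].
- have b0 : thead b1 = thead b2 by apply: b12; rewrite jk neq_lift.
  rewrite b0; apply: product_measure1_le => // x.
  apply: (IHn k) => //.
  + by move=> i ik; rewrite !tnth_behead' b12// jk (inj_eq lift_inj).
  + exact: measurable_xsection.
  + move=> y /xsectionP /h; rewrite jk !tnth_behead'.
    by rewrite /Defs.cons_tuple tnthS.
- have -> : behead_tuple b1 = behead_tuple b2.
    by apply: eq_from_tnth => i; rewrite !tnth_behead' b12// j0 eq_sym neq_lift.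
  apply: product_measure2_le => // y.
  apply: normal_prob_scale_le => //.
  + exact: measurable_ysection.
  + by move=> x /ysectionP /h; rewrite j0.
Qed.

End normal_law_shift.

(** * The Neyman-Pearson inequality for one coordinate *)

Section neyman_pearson.
Context {R : realType}.

Let fine_measureDI d (T : measurableType d) (P : probability T R) (A B : set T) :
  measurable A -> measurable B ->
  fine (P A) = fine (P (A `\` B)) + fine (P (A `&` B)).
Proof.
move=> mA mB; rewrite (measureDI P mA mB) fineD//; apply: fin_num_measure.
- exact: measurableD.
- exact: measurableI.
Qed.

Lemma measurable_tnth_ge n (j : 'I_n) (t : R) :
  measurable [set y : n.-tuple R | t <= tnth y j].
Proof.
rewrite (_ : [set y : n.-tuple R | _] = (@tnth n R)^~ j @^-1` `[t, +oo[).
  by rewrite -[X in measurable X]setTI; exact: measurable_tnth.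
by apply/seteqP; split => y /=; rewrite in_itv/= andbT.
Qed.

Lemma normal_law_tailE n (b : n.-tuple R) (j : 'I_n) (t : R) :
  normal_law b [set y | t <= tnth y j] = (Phi (tnth b j - t))%:E.
Proof.
pose A (i : 'I_n) : set R := if i == j then `[t, +oo[%classic else setT.
have mA i : measurable (A i) by rewrite /A; case: ifP.
rewrite (_ : [set y | _] = [set y | forall i, A i (tnth y i)]).
  rewrite normal_law_box// (bigD1 j)//= big1 ?mule1.
    by rewrite /A eqxx normal_prob_tailE.
  by move=> i /negbTE ij; rewrite /A ij; exact: probability_setT.
apply/seteqP; split => y /=.
  by move=> ty i; rewrite /A; case: eqP => [->|]//=; rewrite in_itv/= ty.
by move=> /(_ j); rewrite /A eqxx/= in_itv/= andbT.
Qed.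

(** [lam] is the likelihood ratio at [y_j = tau]. As the ratio is nondecreasing in [y_j], it is at
    most [lam] on [A] minus [B] and at least [lam] on [B] minus [A], where [B] is the test
    [tau <= y_j]; the common part of [A] and [B] cancels on both sides. *)
Lemma neyman_pearson n (j : 'I_n) (b0 b1 : n.-tuple R) (t tau : R)
    (A : set (n.-tuple R)) (lam := expR (t * (tau - tnth b0 j) - t ^+ 2 / 2)) :
  measurable A -> 0 <= t ->
  tnth b1 j = tnth b0 j + t -> (forall i, i != j -> tnth b1 i = tnth b0 i) ->
  fine (normal_law b1 A) - Phi (tnth b1 j - tau) <=
  lam * (fine (normal_law b0 A) - Phi (tnth b0 j - tau)).
Proof.
move=> mA t0 bj bi; set B := [set y : n.-tuple R | tau <= tnth y j].
have mB : measurable B := measurable_tnth_ge j tau.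
have lam0 : 0 <= lam := expR_ge0 _.
have pdfE (x : R) : normal_pdf (tnth b1 j) 1 x =
    expR (t * (x - tnth b0 j) - t ^+ 2 / 2) * normal_pdf (tnth b0 j) 1 x.
  rewrite !normal_pdf1E mulrCA -expRD bj; by congr (_ * expR _); field.
have le1 : fine (normal_law b1 (A `\` B)) <= lam * fine (normal_law b0 (A `\` B)).
  have mAB := measurableD mA mB.
  rewrite -lee_fin EFinM !fineK; try exact: fin_num_measure.
  rewrite -[leLHS]mul1e; apply: (@normal_law_scale_le _ _ j) => // y [_ /negP].
  rewrite -ltNge => /ltW ytau; rewrite mul1r pdfE.
  rewrite ler_wpM2r ?normal_pdf_ge0// ler_expR lerD2r ler_wpM2l//.
  by rewrite lerD2r.
have le2 : lam * fine (normal_law b0 (B `\` A)) <= fine (normal_law b1 (B `\` A)).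
  have mBA := measurableD mB mA.
  rewrite -lee_fin EFinM !fineK; try exact: fin_num_measure.
  rewrite -[leRHS]mul1e; apply: (@normal_law_scale_le _ _ j) => //.
    by move=> i /bi.
  move=> y [By _]; rewrite mul1r pdfE.
  rewrite ler_wpM2r ?normal_pdf_ge0// ler_expR lerD2r ler_wpM2l//.
  by rewrite lerD2r.
have tE b : Phi (tnth b j - tau) = fine (normal_law b B).
  by rewrite /B normal_law_tailE.
rewrite !tE !(fine_measureDI _ mA mB) !(fine_measureDI _ mB mA) (setIC B).
rewrite (_ : forall a b c : R, a + b - (c + b) = a - c); last by move=> *; ring.
rewrite (_ : forall a b c : R, a + b - (c + b) = a - c); last by move=> *; ring.
by rewrite mulrBr; lra.
Qed.

End neyman_pearson.

(** * Averaging over pairs of a support and a coordinate *)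

Section averaging.
Context {R : realType}.

(** For each fixed [j], adding [j] is a bijection from the supports of size [s] avoiding [j] to
    those of size [s.+1] containing it. *)
Lemma sum_setU1 n (s : nat) (F : {set 'I_n} -> 'I_n -> R) :
  \sum_(S : {set 'I_n} | #|S| == s) \sum_(j in ~: S) F (j |: S)%SET j =
  \sum_(S : {set 'I_n} | #|S| == s.+1) \sum_(j in S) F S j.
Proof.
rewrite (exchange_big_dep predT)//= [RHS](exchange_big_dep predT)//=.
apply: eq_bigr => j _.
rewrite [RHS](reindex_onto (fun S => j |: S)%SET (fun S => S :\ j)%SET)/=.
  apply: eq_bigl => S; rewrite finset.in_setC.
  have [jS|jS] := boolP (j \in S).
    rewrite andbF; symmetry; apply/negbTE; rewrite negb_and; apply/orP; right.
    by apply: contraTneq jS => <-; rewrite finset.setD11.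
  by rewrite andbT cardsU1 jS add1n eqSS finset.setU11 andbT finset.setU1K// eqxx andbT.
by move=> S /andP[_ jS]; rewrite finset.setD1K.
Qed.

(** [p S j] stands for the probability that [j] is declared nonzero when the support is [S]. If
    every support of size [s] failed, the sum over all pairs of [p (j |: S) j - (1 - 1 / c)] would
    be negative by [np], yet it is nonnegative by [risk]. *)
Lemma exists_support_detected_ge n (s : nat) (p : {set 'I_n} -> 'I_n -> R) (c lam p0 : R) :
  (s < n)%N -> 0 < lam ->
  (forall S : {set 'I_n}, #|S| = s.+1 ->
     \sum_(j in S) (1 - p S j) <= s.+1%:R / c) ->
  (forall (S : {set 'I_n}) j, j \notin S ->
     p (j |: S)%SET j - (1 - 1 / c) <= lam * (p S j - p0)) ->
  exists2 S : {set 'I_n}, #|S| = s &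
    (n - s)%:R * p0 <= \sum_(j in ~: S) p S j.
Proof.
move=> sn lam0 risk np; apply: contrapT => /forall2NP h.
have [S0 cS0] : exists S : {set 'I_n}, #|S| = s.
  have : (0 < #|[set S : {set 'I_n} | #|S| == s]%SET|)%N.
    by rewrite card_draws card_ord bin_gt0 ltnW.
  by move=> /card_gt0P[S]; rewrite inE => /eqP; exists S.
suff : 0 < 0 :> R by rewrite ltxx.
apply: (@le_lt_trans _ _ (\sum_(S : {set 'I_n} | #|S| == s)
    \sum_(j in ~: S) (p (j |: S)%SET j - (1 - 1 / c)))).
  rewrite (sum_setU1 s (fun S j => p S j - (1 - 1 / c))).
  apply: sumr_ge0 => S /eqP cS.
  rewrite (_ : \sum_(j in S) _ = s.+1%:R / c - \sum_(j in S) (1 - p S j)).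
    by rewrite subr_ge0 risk.
  rewrite !sumrB !sumr_const cS -[_ *+ s.+1]mulr_natl.
  by rewrite -[(1 / c) *+ _]mulr_natl; lra.
apply: (@le_lt_trans _ _ (\sum_(S : {set 'I_n} | #|S| == s)
    lam * (\sum_(j in ~: S) p S j - (n - s)%:R * p0))).
  apply: ler_sum => S /eqP cS.
  apply: (@le_trans _ _ (\sum_(j in ~: S) lam * (p S j - p0))).
    by apply: ler_sum => j; rewrite finset.in_setC => /np.
  rewrite -mulr_sumr sumrB sumr_const cardsCs finset.setCK card_ord cS mulr_natl.
  exact: lexx.
rewrite -mulr_sumr pmulr_rlt0//.
(* Strict negativity of the sum requires at least one support of size [s], namely [S0]. *)
rewrite (bigD1 S0)/=; last by rewrite cS0.
have neg (S : {set 'I_n}) : #|S| = s ->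
    \sum_(j in ~: S) p S j - (n - s)%:R * p0 < 0.
  by move=> cS; have [//|/negP] := h S; rewrite -ltNge subr_lt0.
rewrite -[ltRHS]addr0 ltr_leD ?neg//.
by apply: sumr_le0 => S /andP[/eqP cS _]; rewrite ltW// neg.
Qed.

End averaging.

(** * The non-asymptotic lower bound *)

Section lower_bound.
Context {R : realType}.
Implicit Types (n s : nat) (t c : R).

Definition spike n t (S : {set 'I_n}) : n.-tuple R :=
  [tuple (if i \in S then t else 0) | i < n].

Lemma tnth_spike n t (S : {set 'I_n}) i :
  tnth (spike t S) i = if i \in S then t else 0.
Proof. by rewrite tnth_mktuple. Qed.

Lemma sparse_spike n s t (S : {set 'I_n}) : (#|S| <= s)%N ->
  sparse s (spike t S).
Proof.
apply: leq_trans; apply/subset_leq_card/fintype.subsetP => j.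
by rewrite inE tnth_spike; case: ifP => //; rewrite eqxx.
Qed.

Section estimator.
Context (n : nat) (bhat : n.-tuple R -> n.-tuple R).
Context (mbhat : measurable_fun [set: n.-tuple R] bhat).

Definition detected j : set (n.-tuple R) := [set y | tnth (bhat y) j != 0].

Let measurable_coord j : measurable_fun setT (fun y => tnth (bhat y) j).
Proof. exact: (measurableT_comp (measurable_tnth j) mbhat). Qed.

Lemma measurable_detected j : measurable (detected j).
Proof.
rewrite (_ : detected j = (fun y => tnth (bhat y) j) @^-1` ~` [set 0]).
  rewrite -[X in measurable X]setTI; apply: measurable_coord => //.
  exact: measurableC.
by apply/seteqP; split => y /= /eqP.
Qed.

(** Linearity of expectation; [t != 0] makes the null coordinates exactly those outside [S]. *)
Lemma expectation_FP_spike t (S : {set 'I_n}) : t != 0 ->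
  ('E_(normal_law (spike t S))[fun y => (FP (spike t S) (bhat y))%:R] =
  (\sum_(j in ~: S) fine (normal_law (spike t S) (detected j)))%:E)%E.
Proof.
move=> t0; rewrite expectation.unlock -sumEFin -[RHS]big_enum.
under [RHS]eq_bigr => j _.
  rewrite fineK; last by apply: fin_num_measure; exact: measurable_detected.
  rewrite -[X in normal_law _ X]setIT -integral_indic//; last first.
    exact: measurable_detected.
  over.
rewrite -ge0_integral_sum//=; last first.
  move=> j; apply/measurable_EFinP; apply: measurable_indic.
  exact: measurable_detected.
apply: eq_integral => y _; rewrite sumEFin big_enum/= /FP -sum1_card natr_sum.
congr EFin; rewrite big_mkcond [RHS]big_mkcond/=; apply: eq_bigr => j _.
rewrite !inE tnth_spike indicE; case: ifP => [/andP[bj]|].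
  case: ifP => [_|_ _]; first by rewrite (negbTE t0).
  by rewrite mem_set.
case: ifP => //= _; rewrite eqxx andbT => bj.
by rewrite memNset// /detected/= bj.
Qed.

(** Only the coordinates of [S] estimated by 0 are kept in the loss; each of them costs exactly
    [t ^+ 2]. *)
Lemma expectation_sqdist_spike_ge t (S : {set 'I_n}) :
  ((\sum_(j in S) t ^+ 2 * (1 - fine (normal_law (spike t S) (detected j))))%:E <=
  'E_(normal_law (spike t S))[fun y => sqdist (spike t S) (bhat y)])%E.
Proof.
have mC j : measurable (~` detected j) by apply: measurableC; exact: measurable_detected.
have mI (j : 'I_n) : measurable_fun [set: n.-tuple R]
    (fun y => (t ^+ 2 * \1_(~` detected j) y)%:E).
  by apply/measurable_EFinP; apply: measurable_funM => //; exact: measurable_indic.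
rewrite expectation.unlock -sumEFin -[leLHS]big_enum.
under eq_bigr => j _.
  rewrite EFinM EFinB fineK; last by apply: fin_num_measure; exact: measurable_detected.
  rewrite -probability_setC; last exact: measurable_detected.
  rewrite -[X in normal_law _ X]setIT -integral_indic//.
  rewrite -ge0_integralZl//=; last 2 first.
  - by apply/measurable_EFinP; exact: measurable_indic.
  - by rewrite lee_fin sqr_ge0.
  over.
rewrite -ge0_integral_sum//=; last first.
  by move=> j y _; rewrite lee_fin mulr_ge0// sqr_ge0.
apply: ge0_le_integral => //.
- by move=> y _; apply: sume_ge0 => j _; rewrite lee_fin mulr_ge0// sqr_ge0.
- exact: emeasurable_sum.
- apply/measurable_EFinP; apply: measurable_sum => j.
  apply: measurable_funX; exact: measurable_funB.
move=> y _; rewrite sumEFin lee_fin big_enum/= /sqdist.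
rewrite [leLHS]big_mkcond/=; apply: ler_sum => j _.
rewrite tnth_spike; case: ifP => _; last exact: sqr_ge0.
rewrite indicE; have [|_] := boolP (y \in _); last by rewrite mulr0 sqr_ge0.
rewrite inE /detected/= => /negP; rewrite negbK => /eqP ->.
by rewrite mulr1 subr0.
Qed.

End estimator.

Lemma minimaxFP_ge (f : nat -> nat -> R) n s c : (1 <= s <= n)%N ->
  0 < f n s -> 1 < c ->
  (((n%:R - s%:R + 1) * Phi (PhiV (1 - 1 / c) - Num.sqrt (c * f n s)))%:E <=
   minimaxFP f n s)%E.
Proof.
(* The sparsity is now [s.+1]: the risk is used on supports of size [s.+1], while false positives
   are counted on supports of size [s], which leave [n - s] null coordinates. Hence the [+ 1] in the
   bound. *)
case: s => // s /= sn f0 c1.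
have c0 : 0 < c by rewrite (lt_trans _ c1).
set t := Num.sqrt _; have t0 : 0 < t by rewrite sqrtr_gt0 mulr_gt0.
have t2 : t ^+ 2 = c * f n s.+1 by rewrite sqr_sqrtr// mulr_ge0// ltW.
apply: le_ereal_inf_tmp => _ [bhat [mbhat risk] <-].
pose p (S : {set 'I_n}) j := fine (normal_law (spike t S) (detected bhat j)).
(* At this threshold the test [tau <= y_j] has power exactly [1 - 1 / c] when the mean is [t], and
   level [Phi (PhiV (1 - 1 / c) - t)] when it is 0. *)
pose tau := t - PhiV (1 - 1 / c).
have [S cS|S j jS|S cS pS] := @exists_support_detected_ge R n s p c
    (expR (t * tau - t ^+ 2 / 2)) (Phi (PhiV (1 - 1 / c) - t)) sn (expR_gt0 _).
- have : (\sum_(j in S) t ^+ 2 * (1 - p S j) <= s.+1%:R * f n s.+1).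
    rewrite -lee_fin; apply: le_trans risk.
    apply: le_trans (expectation_sqdist_spike_ge mbhat t S) _.
    apply: ereal_sup_ubound; exists (spike t S) => //.
    by apply: sparse_spike; rewrite cS.
  rewrite -mulr_sumr t2 mulrAC -mulrA => h.
  rewrite ler_pdivlMr// mulrC -(ler_pM2r f0).
  by move: h; lra.
- have := @neyman_pearson R n j (spike t S) (spike t (j |: S)%SET) t tau
    (detected bhat j) (measurable_detected mbhat j) (ltW t0).
  rewrite !tnth_spike finset.setU11 (negbTE jS) add0r subr0 sub0r /tau.
  rewrite subKr opprB PhiVK_inv//; apply => //.
  by move=> i ij; rewrite !tnth_spike in_setU1 (negbTE ij).
apply: (@le_trans _ _ (\sum_(j in ~: S) p S j)%:E).
  rewrite lee_fin; apply: le_trans pS.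
  by rewrite natrB ?(ltnW sn)// -[s.+1%:R]natr1 opprD addrA subrK.
rewrite -expectation_FP_spike ?gt_eqF//.
apply: ereal_sup_ubound; exists (spike t S) => //.
by apply: sparse_spike; rewrite cS.
Qed.

Lemma minimaxFP_ge_Hfun (f : nat -> nat -> R) n s : (1 <= s <= n)%N ->
  0 < f n s ->
  (((n%:R - s%:R + 1) * Hfun (f n s))%:E <= minimaxFP f n s)%E.
Proof.
move=> sn f0; have ns0 : 0 < n%:R - s%:R + 1 :> R.
  by rewrite ltr_wpDl// subr_ge0 ler_nat; case/andP: sn.
have := @minimaxFP_ge f n s _ sn f0.
case: minimaxFP => [r h|_|/(_ 2)].
- rewrite lee_fin mulrC -ler_pdivlMr//; apply: Hfun_le => c c1.
  by rewrite ler_pdivlMr// mulrC -lee_fin h.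
- by rewrite leey.
- by rewrite ltr1n => /(_ isT); rewrite leeNy_eq.
Qed.

End lower_bound.

(** * Limits superior and inferior of extended real sequences *)

Section limits.
Context {R : realType}.
Implicit Types (u : nat -> \bar R) (a : \bar R).
Local Open Scope ereal_scope.

Lemma limn_esup_lt u a : limn_esup u < a -> \forall n \near \oo, u n < a.
Proof.
move=> /ereal_inf_lt[_ [V FV <-] Va]; apply: filterS FV => n Vn.
by apply: le_lt_trans Va; apply: ereal_sup_ubound; exists n.
Qed.

(** Up to signs, [limn_einf] is an infimum of suprema over the sets of the filter; the set where
    [a <= u n] is one of them. *)
Lemma limn_einf_ge u a : (\forall n \near \oo, a <= u n) -> a <= limn_einf u.
Proof.
move=> au; rewrite /limn_einf leeNr.
apply: (@le_trans _ _ (ereal_sup [set - u n | n in [set n | a <= u n]])).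
  by apply: ereal_inf_lbound; exists [set n | a <= u n].
by apply: ge_ereal_sup => _ [n /= an <-]; rewrite leeN2.
Qed.

End limits.

(** * The two asymptotic regimes *)

Section asymptotics.
Context {R : realType}.
Context (s : nat -> nat) (f : nat -> nat -> R).
Context (sP : forall n, (0 < n)%N -> (1 <= s n <= n)%N).
Context (fP : exists2 d : R, 0 < d & forall n, (0 < n)%N -> d <= f n (s n)).

Let f_gt0 n : (0 < n)%N -> 0 < f n (s n).
Proof. by case: fP => d d0 df n0; exact: lt_le_trans d0 (df n n0). Qed.

Lemma limn_esup_risk_gt0 (k : R) :
  limn_esup (fun n => (f n (s n))%:E) = k%:E -> 0 < k.
Proof.
case: fP => d d0 df fk; apply: lt_le_trans d0 _; rewrite leNgt; apply/negP => kd.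
have : (limn_esup (fun n => (f n (s n))%:E) < d%:E)%E by rewrite fk lte_fin.
move=> /limn_esup_lt fd; near \oo => n.
have : ((f n (s n))%:E < d%:E)%E by near: n.
by rewrite lte_fin ltNge df//; near: n; exact: nbhs_infty_gt.
Unshelve. all: by end_near. Qed.

Lemma continuous_Hterm (c k : R) :
  {for k, continuous (fun x => Phi (PhiV (1 - 1 / c) - Num.sqrt (c * x)))}.
Proof.
apply: continuous_comp; last exact: continuous_Phi.
apply: continuousB; first exact: cvg_cst.
apply: continuous_comp; last exact: sqrt_continuous.
by apply: continuousM; [exact: cvg_cst|exact: cvg_id].
Qed.

Context (z : R) (z01 : 0 <= z < 1).
Context (sz : limn_esup (fun n => ((s n)%:R / n%:R)%:E) = z%:E).

Let ratio_lt (e : R) : 0 < e -> \forall n \near \oo, (s n)%:R / n%:R < z + e.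
Proof.
move=> e0; have /limn_esup_lt : (limn_esup (fun n => ((s n)%:R / n%:R)%:E) < (z + e)%:E)%E.
  by rewrite sz lte_fin ltrDl.
by apply: filterS => n; rewrite lte_fin.
Qed.

(** The limit is taken for each fixed [c], with a loss [e]; then [e] tends to 0, and the supremum
    over [c] comes last. *)
Lemma limn_einf_minimaxFP_ge (k : R) :
  limn_esup (fun n => (f n (s n))%:E) = k%:E ->
  ((Hfun k * (1 - z))%:E <=
   limn_einf (fun n => (n%:R^-1)%:E * minimaxFP f n (s n)))%E.
Proof.
move=> fk; set L := limn_einf _; case/andP: z01 => z0 z1.
have key c e : 1 < c -> 0 < e ->
    ((Phi (PhiV (1 - 1 / c) - Num.sqrt (c * k)) * (1 - z) - e)%:E <= L)%E.
  move=> c1 e0; have c0 : 0 < c by rewrite (lt_trans _ c1).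
  pose v x := Phi (PhiV (1 - 1 / c) - Num.sqrt (c * x)); rewrite -/(v k).
  have e20 : 0 < e / 2 by rewrite divr_gt0.
  (* A limit superior equal to [k] gives [f n (s n) < k'] eventually only for [k' > k]; continuity
     makes the move to [k'] cost at most [e / 2]. *)
  have [k' [kk' vk']] : exists k', k < k' /\ v k - e / 2 <= v k'.
    have /cvgrPdist_le/(_ _ e20) nv := @continuous_Hterm c k.
    near k^'+ => k'; exists k'; split; first by near: k'; exact: nbhs_right_gt.
    have : `|v k - v k'| <= e / 2 by near: k'; exact: cvg_within.
    by rewrite ler_norml => /andP[_]; rewrite lerBlDr lerBlDl addrC.
  apply: limn_einf_ge.
  have /limn_esup_lt fk' : (limn_esup (fun n => (f n (s n))%:E) < k'%:E)%E.
    by rewrite fk lte_fin.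
  near=> n.
  have n0 : (0 < n)%N by near: n; exact: nbhs_infty_gt.
  have nR0 : 0 < n%:R :> R by rewrite ltr0n.
  have fnk : f n (s n) < k' by rewrite -lte_fin; near: n.
  have sn : (s n)%:R / n%:R < z + e / 2 by near: n; exact: ratio_lt.
  have sn1 : (s n)%:R / n%:R <= 1 :> R.
    by rewrite ler_pdivrMr// mul1r ler_nat; case/andP: (sP n0).
  have vf : v k' <= v (f n (s n)).
    by rewrite Phi_mono lerD2l lerN2 ler_wsqrtr// ler_pM2l// ltW.
  have nV0 : (0 <= (n%:R^-1 : R)%:E)%E by rewrite lee_fin invr_ge0 ltW.
  apply: le_trans (lee_wpmul2l nV0 (minimaxFP_ge (sP n0) (f_gt0 n0) c1)).
  rewrite -EFinM lee_fin -/(v _).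
  have -> : n%:R^-1 * ((n%:R - (s n)%:R + 1) * v (f n (s n))) =
      (1 - (s n)%:R / n%:R + n%:R^-1) * v (f n (s n)).
    by field; rewrite gt_eqF.
  set r := _ / _ in sn sn1 *.
  apply: (@le_trans _ _ ((1 - r) * v k')); last first.
    have r0 : 0 <= 1 - r by rewrite subr_ge0.
    apply: (@le_trans _ _ ((1 - r) * v (f n (s n)))); first exact: ler_wpM2l.
    by apply: ler_wpM2r; [exact: Phi_ge0|rewrite lerDl invr_ge0 ltW].
  have v0 : 0 <= v k' := Phi_ge0 _.
  have v1 : v k' <= 1 := Phi_le1 _.
  move: vk' sn e0 z0 z1 v0 v1; clear; move: (v k) (v k') => x y.
  nra.
have key0 c : 1 < c ->
    ((Phi (PhiV (1 - 1 / c) - Num.sqrt (c * k)) * (1 - z))%:E <= L)%E.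
  by move=> c1; apply/lee_subgt0Pr => e e0; rewrite -EFinB; exact: key.
(* [L] is an extended real: the value [+oo] is trivial, and the term [c = 2] rules out [-oo]. *)
case: L key0 {key} => [r h|_|/(_ 2)].
- rewrite lee_fin -ler_pdivlMr ?subr_gt0//; apply: Hfun_le => c c1.
  by rewrite ler_pdivlMr ?subr_gt0// -lee_fin h.
- by rewrite leey.
- by rewrite ltr1n => /(_ isT); rewrite leeNy_eq.
Unshelve. all: by end_near. Qed.

(** [eps n] is at least the solution of [Hfun (f n (s n)) = expR (- ((1 + eps) * f n (s n) / 2))];
    the maximum with [1 / (n + 1)] makes it positive. It tends to 0 by [Hfun_ge_expR], applied to
    every [e > 0]. *)
Lemma minimaxFP_ge_expR : f n (s n) @[n --> \oo] --> +oo ->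
  exists eps : nat -> R,
    [/\ forall n, 0 < eps n,
        eps n @[n --> \oo] --> (0 : R)
      & \forall n \near \oo,
          ((1 / 2 * (1 - z) * n%:R *
            expR (- ((1 + eps n) * f n (s n) / 2)))%:E
           <= minimaxFP f n (s n))%E].
Proof.
move=> foo; case/andP: z01 => z0 z1.
have linE (x y w : R) : (- (w + 1) * y <= 2 * x) = (- ((1 + w) * y / 2) <= x).
  by apply/idP/idP; lra.
exists (fun n => Num.max n.+1%:R^-1 (- (2 * ln (Hfun (f n (s n))) / f n (s n)) - 1)).
have eps0 n : 0 < Num.max (n.+1%:R^-1 : R)
    (- (2 * ln (Hfun (f n (s n))) / f n (s n)) - 1).
  by rewrite lt_max invr_gt0 ltr0n.
split => //.
- apply/cvgrPdist_le => e e0; have [K HK] := Hfun_ge_expR e0.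
  near=> n.
  have fn0 : 0 < f n (s n) by apply: f_gt0; near: n; exact: nbhs_infty_gt.
  rewrite sub0r normrN ger0_norm; last exact: ltW.
  rewrite ge_max; apply/andP; split.
    by rewrite ltW//; near: n; exact: near_infty_natSinv_lt (PosNum e0).
  have fK : K <= f n (s n).
    by near: n; move/cvgryPge : foo; exact.
  have h : - ((1 + e) * f n (s n) / 2) <= ln (Hfun (f n (s n))).
    by rewrite -ler_expR lnK ?posrE ?Hfun_gt0// HK.
  by rewrite lerBlDr lerNl ler_pdivlMr// linE.
- near=> n.
  have n0 : (0 < n)%N by near: n; exact: nbhs_infty_gt.
  have nR0 : 0 < n%:R :> R by rewrite ltr0n.
  have fn0 : 0 < f n (s n) := f_gt0 n0.
  set eps := Num.max _ _.
  have He : expR (- ((1 + eps) * f n (s n) / 2)) <= Hfun (f n (s n)).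
    rewrite -[Hfun _]lnK ?posrE ?Hfun_gt0// ler_expR.
    have : - (2 * ln (Hfun (f n (s n))) / f n (s n)) - 1 <= eps.
      by rewrite le_max lexx orbT.
    by rewrite lerBlDr lerNl ler_pdivlMr// linE.
  (* The constant [1 / 2] comes from here: eventually [1 - s n / n > (1 - z) / 2]. *)
  have sn : (s n)%:R / n%:R < z + (1 - z) / 2.
    by near: n; apply: ratio_lt; rewrite divr_gt0// subr_gt0.
  apply: le_trans (minimaxFP_ge_Hfun (sP n0) fn0); rewrite lee_fin.
  apply: ler_pM => //.
  + by rewrite !mulr_ge0// ?subr_ge0 ltW.
  + move: sn; rewrite ltr_pdivrMr// => sn.
    lra.
Unshelve. all: by end_near. Qed.

End asymptotics.

Theorem theorem2p1 (R : realType) :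
  [/\ forall k : R, 0 < k -> 0 < Hfun k < 1,
      forall k k' : R, 0 < k -> k < k' -> Hfun k' < Hfun k
    & exists2 C : R, 0 < C &
      forall (s : nat -> nat) (f : nat -> nat -> R),
      (forall n, (0 < n)%N -> (1 <= s n <= n)%N) ->
      (exists2 d : R, 0 < d & forall n, (0 < n)%N -> d <= f n (s n)) ->
      (forall n, (0 < n)%N ->
         (((n%:R - (s n)%:R + 1) *
           sup [set Phi (PhiV (1 - 1 / c) - Num.sqrt (c * f n (s n)))
               | c in [set c : R | 1 < c]])%:E <= minimaxFP f n (s n))%E) /\
      forall z : R, 0 <= z < 1 ->
      limn_esup (fun n => ((s n)%:R / n%:R)%:E) = z%:E ->
      (forall k : R, limn_esup (fun n => (f n (s n))%:E) = k%:E ->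
         0 < Hfun k < 1 /\
         ((Hfun k * (1 - z))%:E <=
          limn_einf (fun n => (n%:R^-1)%:E * minimaxFP f n (s n)))%E) /\
      (f n (s n) @[n --> \oo] --> +oo ->
         exists eps : nat -> R,
           [/\ forall n, 0 < eps n,
               eps n @[n --> \oo] --> (0 : R)
             & \forall n \near \oo,
                 ((C * (1 - z) * n%:R *
                   expR (- ((1 + eps n) * f n (s n) / 2)))%:E
                  <= minimaxFP f n (s n))%E])].
Proof.
split; [exact: Hfun_bounds|exact: Hfun_decreasing|].
exists (1 / 2) => [|s f sP fP]; first by rewrite divr_gt0.
split => [n n0|z z01 sz].
  (* The supremum written out in the statement is [Hfun (f n (s n))] unfolded. *)
  apply: minimaxFP_ge_Hfun (sP n n0) _.
  by case: fP => d d0 df; exact: lt_le_trans d0 (df n n0).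
split => [k fk|]; last exact: minimaxFP_ge_expR.
split; last exact: limn_einf_minimaxFP_ge.
exact: Hfun_bounds (limn_esup_risk_gt0 fP fk).
Qed.
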